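(* For every constant $c<1$ there exists an integer $n_c$ such that for all $n>n_c$, at least $c^n n!$ patterns $\pi$ of length $n$ satisfy a nontrivial c-forest-Wilf equivalence, i.e. there is a pattern $\pi'$ of length $n$ with $\pi'\ne\pi$ and $\pi'\ne\overline\pi$ that is c-forest-Wilf equivalent to $\pi$.
   Context: A rooted labeled forest on $[n]$ is an unordered forest on $n$ vertices, each component with a distinguished root, with distinct vertex labels from $[n]$. A pattern of length $k$ is a permutation of $[k]$; its complement is $\overline\pi=(k+1-\pi(1))\cdots(k+1-\pi(k))$. A consecutive instance of $\pi$ in a forest is a downward path $v_1,\dots,v_k$ ($v_i$ the parent of $v_{i+1}$) whose labels are in the same relative order as $\pi$. Two patterns are c-forest-Wilf equivalent if for every $n\ge0$ the numbers of rooted labeled forests on $[n]$ with no consecutive instance of each of them are equal.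
   Formalization: The constant c is taken with 0 < c < 1: for c < -1 and even n the bound c^n n! exceeds the number n! of all patterns, so the literal claim fails, while for -1 < c <= 0 it follows from the positive case. *)

(* Defs.v *)
From HB Require Import structures.
From mathcomp Require Import all_boot all_order all_algebra all_fingroup.
From mathcomp Require Import reals.
Set Implicit Arguments. Unset Strict Implicit. Unset Printing Implicit Defensive.

(* A rooted labeled forest on [n] (vertices/labels 'I_n = {0,...,n-1}, which is
   order-isomorphic to [n]) is encoded by its parent function: p v = None iff v
   is a root, p v = Some u iff u is the parent of v.  It is a forest iff
   following parents from any vertex reaches a root, i.e. after n steps we have
   left the forest.  This is a bijection between rooted labeled forests
   (unordered, with a distinguished root per component) and such functions. *)
Definition parent_fun (n : nat) := {ffun 'I_n -> option 'I_n}.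

Definition is_forest (n : nat) (p : parent_fun n) : bool :=
  [forall v : 'I_n, iter n (fun o => obind p o) (Some v) == None].

Definition has_instance (n k : nat) (p : parent_fun n) (pi : 'S_k) : bool :=
  [exists w : {ffun 'I_k -> 'I_n},
     [forall i : 'I_k, forall j : 'I_k,
        ((val j == (val i).+1) ==> (p (w j) == Some (w i)))
        && ((w i < w j)%N == (pi i < pi j)%N)]].

Definition avoiders (n k : nat) (pi : 'S_k) : {set parent_fun n} :=
  [set p : parent_fun n | is_forest p && ~~ has_instance p pi].

Definition cforest_wilf_equiv (k : nat) (pi sigma : 'S_k) : Prop :=
  forall n : nat, #|avoiders n pi| = #|avoiders n sigma|.

(* complement of a pattern: i |-> k+1 - pi(i) (0-based: k-1 - pi i) *)
Lemma compl_inj (k : nat) (pi : 'S_k) : injective (fun i => rev_ord (pi i)).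
Proof. move=> i j /= /rev_ord_inj H; exact: (@perm_inj _ pi i j H). Qed.

Definition compl (k : nat) (pi : 'S_k) : 'S_k := perm (@compl_inj k pi).

(* Main.v *)
(* The patterns pi = 2 5 rho 3 1 x 4 of length k >= 7 number (k-5)!, which exceeds
   c^k k! for large k, and each is equivalent to pi' = 2 5 rho 4 1 x 3.

   To pass from pi to pi', change the forbidden pattern for one value y of the
   second vertex of an instance at a time.  Let M be the set of vertices that
   occupy position k-3 or k of an instance, with second vertex y, of pi or pi'.
   In the order of labels M lies strictly between the parent of y and y, while
   all other vertices of these instances lie outside this interval.  Hence
   reversing the order of the labels of M, by exchanging the places of these
   vertices, turns instances of pi at y into instances of pi' and back.  The
   exchange does not affect instances with another second vertex, because no
   window of pi of length at least 2, not starting at position 1 and containing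
   position k-3 or k, is order-isomorphic to a prefix of pi. *)
Require Import Defs.
From HB Require Import structures.
From mathcomp Require Import all_boot all_order all_algebra all_fingroup.
From mathcomp Require Import reals.
From mathcomp Require Import zify lra.
Import Order.TTheory GRing.Theory Num.Theory.
Local Open Scope ring_scope.
Set Implicit Arguments.
Unset Strict Implicit.

(** * Reversal of a finite sequence as an involution *)

Section SeqReversal.
Local Open Scope nat_scope.
Context (T : eqType) (s : seq T).
Hypothesis s_uniq : uniq s.

Definition flip_in (x : T) : T :=
  if x \in s then nth x (rev s) (index x s) else x.

Lemma flip_in_out x : x \notin s -> flip_in x = x.
Proof. by rewrite /flip_in => /negPf->. Qed.

Lemma flip_in_nth x0 i : i < size s ->
  flip_in (nth x0 s i) = nth x0 s (size s - i.+1).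
Proof.
move=> ltis; rewrite /flip_in mem_nth // index_uniq // nth_rev //.
by apply: set_nth_default; lia.
Qed.

Lemma flip_in_mem x : (flip_in x \in s) = (x \in s).
Proof.
have [sx|/[dup]/flip_in_out-> /negPf->//] := boolP (x \in s).
have ltx : index x s < size s by rewrite index_mem.
by rewrite -{1}(nth_index x sx) flip_in_nth // mem_nth //; lia.
Qed.

Lemma flip_inK : involutive flip_in.
Proof.
move=> x; have [sx|nsx] := boolP (x \in s); last by rewrite !flip_in_out.
have ltx : index x s < size s by rewrite index_mem.
rewrite -[in LHS](nth_index x sx) !flip_in_nth; try lia.
by rewrite -[RHS](nth_index x sx); congr nth; lia.
Qed.
End SeqReversal.

(** In a sorted sequence labels compare like positions, and the flip mirrors positions. *)
Lemma flip_in_ltn (n : nat) (s : seq 'I_n) (x y : 'I_n) :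
    sorted ltn (map val s) -> x \in s -> y \in s ->
  (flip_in s x < flip_in s y)%N = (y < x)%N.
Proof.
move=> srt sx sy.
have s_uniq : uniq s.
  by rewrite -(map_inj_uniq val_inj) (sorted_uniq ltn_trans ltnn srt).
have nth_lt i j : (i < size s)%N -> (j < size s)%N ->
    (nth x s i < nth x s j)%N = (i < j)%N.
  move=> si sj; rewrite -!(nth_map x (val x) val) //.
  by apply: (lt_sorted_ltn_nth (val x) srt); rewrite inE size_map.
have ltx : (index x s < size s)%N by rewrite index_mem.
have lty : (index y s < size s)%N by rewrite index_mem.
have flipE z : z \in s -> flip_in s z = nth x s (size s - (index z s).+1).
  by move=> sz; rewrite -{1}(nth_index x sz) flip_in_nth // index_mem.
have <- : (index y s < index x s)%N = (y < x)%N by rewrite -nth_lt // !nth_index.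
by rewrite !flipE // nth_lt; lia.
Qed.

Lemma sorted_enum_set (n : nat) (A : {set 'I_n}) : sorted ltn (map val (enum A)).
Proof.
rewrite -[enum _]/(filter (mem A) (Finite.enum 'I_n)) -enumT sorted_map.
apply: sorted_filter; first by move=> a b c; apply: ltn_trans.
by rewrite -sorted_map val_enum_ord iota_ltn_sorted.
Qed.

(** * Forests as well-founded parent functions *)

Section Forests.
Local Open Scope nat_scope.
Context (n : nat).
Implicit Types p : parent_fun n.

Inductive rooted p (v : 'I_n) : Prop :=
| IsRoot of p v = None
| HasRootedParent u of p v = Some u & rooted p u.

(** [None] is a fixed point, and a shortest route to it visits distinct elements of [option 'I_n],
    which has [n + 1] of them, so at most [n] steps are needed. *)
Lemma rooted_is_forest p : (forall v, rooted p v) -> is_forest p.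
Proof.
move=> rt; apply/forallP=> v; set f := fun o => obind p o.
have iterN N : iter N f None = None by elim: N => //= N ->.
have : fconnect f (Some v) None.
  elim: {v}(rt v) => v => [pv|u pv _ IH].
    by have := fconnect1 f (Some v); rewrite [f _]/= pv.
  apply: connect_trans IH; have := fconnect1 f (Some v).
  by rewrite [f _]/= pv.
move=> vN; have := findex_max vN; have := iter_findex vN.
set N := findex _ _ _ => eN ltN.
have {}ltN : N <= n.
  rewrite -ltnS; apply: leq_trans ltN _.
  by rewrite /order (leq_trans (max_card _)) // card_option card_ord.
have -> : iter n f (Some v) = iter (n - N) f (iter N f (Some v)).
  by rewrite -iterD subnK.
by rewrite eN iterN.
Qed.

Lemma forest_height p : is_forest p ->
  exists h : 'I_n -> nat, forall v u, p v = Some u -> h u < h v.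
Proof.
move=> /forallP fp; set f := fun o => obind p o.
(* The height is the number of vertices on the path from [v] to its root. In a forest the last
   summand vanishes, which makes the index shift exact. *)
exists (fun v => \sum_(i < n.+1) (iter i f (Some v) != None)) => v u pv.
rewrite [X in X < _]big_ord_recr [X in _ < X]big_ord_recl /=.
rewrite (eqP (fp u)) /= addn0 add1n ltnS; apply/eq_leq/eq_bigr => i _.
by rewrite -iterS iterSr [f (Some v)]/= pv.
Qed.
End Forests.

(** * Weak instances and the exchange at a second vertex *)

Section Exchange.
Local Open Scope nat_scope.
(* The 0-based word of the pattern, of length m + 7. *)
Context (m : nat) (s : nat -> nat).
Hypotheses (s0 : s 0 = 1) (s1 : s 1 = 4) (s3 : s m.+3 = 2) (s4 : s m.+4 = 0).
Hypothesis (s6 : s m.+4.+2 = 3).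
Hypothesis s_big : forall i, 1 < i < m.+4.+2 -> i != m.+3 -> i != m.+4 -> 4 < s i.

Definition swapped (i j : nat) : bool :=
  (i == m.+3) && (j == m.+4.+2) || (i == m.+4.+2) && (j == m.+3).

Context (n : nat).
Implicit Types (p : parent_fun n) (w : nat -> 'I_n) (y z : 'I_n).

(* Both patterns of the exchanged pair induce the same relative orders except
   between the two swapped positions, so an instance of either one is a weak
   instance with the order at these positions prescribed. *)
Definition weak_instance p w : Prop :=
  (forall i, i < m.+4.+2 -> p (w i.+1) = Some (w i)) /\
  (forall i j, i < m.+4.+3 -> j < m.+4.+3 -> ~~ swapped i j ->
     (w i < w j) = (s i < s j)).

(** Finite functions make the condition decidable, as the sets below require; words on all of [nat]
    keep the arithmetic of positions free of bounds. *)
Definition weak_instanceb p (w : {ffun 'I_m.+4.+3 -> 'I_n}) : bool :=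
  [forall i : 'I_m.+4.+3, forall j : 'I_m.+4.+3,
     ((val j == i.+1) ==> (p (w j) == Some (w i))) &&
     (~~ swapped i j ==> ((w i < w j) == (s i < s j)))].

Lemma weak_instanceP p (w : {ffun 'I_m.+4.+3 -> 'I_n}) :
  reflect (weak_instance p (fun i => w (inord i))) (weak_instanceb p w).
Proof.
apply: (iffP forallP) => [W|[Wp Wo] i].
  split=> [i ltim|i j ltim ltjm ns].
    have /forallP/(_ (inord i.+1))/andP[+ _] := W (inord i).
    by rewrite /= !inordK ?eqxx /= => [/eqP//||]; lia.
  have /forallP/(_ (inord j))/andP[_] := W (inord i).
  by rewrite !inordK // => /implyP/(_ ns)/eqP.
apply/forallP=> j; apply/andP; split; apply/implyP.
  move=> /eqP ji; have im : i < m.+4.+2.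
    by have := ltn_ord j; rewrite -[nat_of_ord j]/(val j) ji.
  by have := Wp i im; rewrite -ji !inord_val => ->.
by move=> /(Wo i j (ltn_ord i) (ltn_ord j)); rewrite !inord_val => ->.
Qed.

Lemma eq_weak_instance p w w' : (forall i, i < m.+4.+3 -> w i = w' i) ->
  weak_instance p w -> weak_instance p w'.
Proof.
move=> ww' [Wp Wo]; split=> [i im|i j im jm ns].
  by rewrite -!ww' ?Wp //; lia.
by rewrite -!ww' // Wo.
Qed.

(** This is the set M of the overview; weak instances cover both patterns at once. *)
Definition exch_set p y : {set 'I_n} :=
  [set x | [exists w : {ffun 'I_m.+4.+3 -> 'I_n},
     [&& weak_instanceb p w, w (inord 1) == y &
         (x == w (inord m.+3)) || (x == w (inord m.+4.+2))]]].

Lemma exch_setP p y x :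
  reflect (exists w, [/\ weak_instance p w, w 1 = y & x = w m.+3 \/ x = w m.+4.+2])
          (x \in exch_set p y).
Proof.
rewrite inE; apply: (iffP existsP) => [[w /and3P[/weak_instanceP W /eqP y1 xw]]|].
  by exists (fun i => w (inord i)); split=> //; case/orP: xw => /eqP; tauto.
case=> w [W wy xw]; exists [ffun i : 'I_m.+4.+3 => w i].
apply/and3P; split; last 2 first.
- by rewrite ffunE inordK ?wy.
- by rewrite !ffunE !inordK; try lia; case: xw => ->; rewrite eqxx ?orbT.
apply/weak_instanceP; apply: eq_weak_instance W => i im.
by rewrite ffunE inordK.
Qed.

Section WeakFacts.
Context (p : parent_fun n) (w : nat -> 'I_n).
Hypothesis W : weak_instance p w.

Lemma weak_parent i : i < m.+4.+2 -> p (w i.+1) = Some (w i).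
Proof. exact: (W.1 i). Qed.

Lemma weak_lt i j : i < m.+4.+3 -> j < m.+4.+3 -> ~~ swapped i j ->
  (w i < w j) = (s i < s j).
Proof. exact: W.2. Qed.

Lemma weak_val01 : w 0 < w 1.
Proof. by rewrite weak_lt ?s0 ?s1 // /swapped; lia. Qed.

Lemma weak_val3 : w 0 < w m.+3 < w 1.
Proof. by rewrite !weak_lt ?s0 ?s1 ?s3 // /swapped; lia. Qed.

Lemma weak_val6 : w 0 < w m.+4.+2 < w 1.
Proof. by rewrite !weak_lt ?s0 ?s1 ?s6 // /swapped; lia. Qed.

Lemma weak_val4 : w m.+4 < w 0.
Proof. by rewrite !weak_lt ?s0 ?s4 // /swapped; lia. Qed.

Lemma weak_val_big i : 1 < i < m.+4.+2 -> i != m.+3 -> i != m.+4 -> w 1 < w i.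
Proof.
by move=> im i3 i4; rewrite weak_lt ?s1 ?s_big // /swapped; lia.
Qed.

(** The only pattern values strictly between [s 0 = 1] and [s 1 = 4] are 2 and 3, held by the two
    swapped positions. *)
Lemma weak_val_other i : i < m.+4.+3 -> i != m.+3 -> i != m.+4.+2 ->
  ~~ (w 0 < w i < w 1).
Proof.
move=> im i3 i6; have := weak_val4; have := @weak_val_big i; have := weak_val01.
have [->|i0] := eqVneq i 0; first lia.
have [->|i1] := eqVneq i 1; first lia.
by have [->|i4] := eqVneq i m.+4; lia.
Qed.
End WeakFacts.

Lemma exch_set_btw p y z x : p y = Some z -> x \in exch_set p y -> z < x < y.
Proof.
move=> pyz /exch_setP[w [W wy xw]].
have := weak_parent W (isT : 0 < m.+4.+2); rewrite wy pyz => -[zw].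
by case: xw => ->; rewrite zw -wy ?(weak_val3 W) ?(weak_val6 W).
Qed.

Lemma weak_notin p w y i : weak_instance p w -> w 1 = y ->
  i < m.+4.+3 -> i != m.+3 -> i != m.+4.+2 -> w i \notin exch_set p y.
Proof.
move=> W wy im i3 i6; have := weak_parent W (isT : 0 < m.+4.+2); rewrite wy => pyz.
apply: contra (weak_val_other W im i3 i6) => /(exch_set_btw pyz).
by rewrite wy.
Qed.

Definition exch_flip p y : 'I_n -> 'I_n := flip_in (enum (exch_set p y)).

Lemma exch_flipK p y : involutive (exch_flip p y).
Proof. by apply: flip_inK; rewrite enum_uniq. Qed.

Lemma exch_flip_in p y x : (exch_flip p y x \in exch_set p y) = (x \in exch_set p y).
Proof. by rewrite -mem_enum flip_in_mem ?enum_uniq ?mem_enum. Qed.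

Lemma exch_flip_out p y x : x \notin exch_set p y -> exch_flip p y x = x.
Proof. by rewrite -mem_enum; apply: flip_in_out. Qed.

Lemma exch_flip_ltn p y x x' : x \in exch_set p y -> x' \in exch_set p y ->
  (exch_flip p y x < exch_flip p y x') = (x' < x).
Proof.
by move=> ? ?; apply: flip_in_ltn; rewrite ?mem_enum // sorted_enum_set.
Qed.

Lemma exch_flip_root p y : exch_flip p y y = y.
Proof.
apply/exch_flip_out/negP => /[dup] /exch_setP[w [W w1 _]].
have := weak_parent W (isT : 0 < m.+4.+2); rewrite w1 => pyz.
by move=> /(exch_set_btw pyz); rewrite ltnn andbF.
Qed.

(* Every vertex of the exchange set takes over the parent and the children below
   z of its mirror image, and keeps its own children above z.  An instance that
   starts at such a vertex begins with an ascent, hence only uses the latter. *)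
Definition exchange y p : parent_fun n :=
  if p y is Some z then
    [ffun c : 'I_n => if (c < z) || (c \in exch_set p y)
               then omap (exch_flip p y) (p (exch_flip p y c)) else p c]
  else p.

Section ExchangeRoot.
Context (p : parent_fun n) (y z : 'I_n).
Hypothesis pyz : p y = Some z.
Let A := exch_set p y.
Let rho := exch_flip p y.

Lemma exchange_moved (c : 'I_n) : (c < z) || (c \in A) ->
  exchange y p c = omap rho (p (rho c)).
Proof. by move=> cA; rewrite /exchange pyz ffunE cA. Qed.

Lemma exchange_kept (c : 'I_n) : ~~ ((c < z) || (c \in A)) -> exchange y p c = p c.
Proof. by move=> /negPf cA; rewrite /exchange pyz ffunE cA. Qed.

Lemma exchange_parent : exchange y p y = Some z.
Proof.
have nAz : z \notin A by apply/negP => /(exch_set_btw pyz); rewrite ltnn.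
have [yA|yA] := boolP ((y < z) || (y \in A)); last by rewrite exchange_kept.
by rewrite exchange_moved // /rho exch_flip_root pyz /= exch_flip_out.
Qed.

(** The flip acts only inside the open interval from [z] to [y]. Of the vertices of [w] exactly
    those at the swapped positions lie there, so every prescribed comparison survives. *)
Lemma weak_flip q (q' : parent_fun n) w : weak_instance q w -> w 0 = z -> w 1 = y ->
    (forall i, i < m.+4.+2 -> q' (rho (w i.+1)) = Some (rho (w i))) ->
  weak_instance q' (fun i => rho (w i)).
Proof.
move=> W w0 w1 Wp; split=> // i j im jm nij; rewrite -(weak_lt W im jm nij).
have special i0 : (i0 == m.+3) || (i0 == m.+4.+2) ->
    (z < w i0 < y) && (z < rho (w i0) < y).
  move=> i0P; have wi0 : z < w i0 < y.
    rewrite -w0 -w1; have := weak_val3 W; have := weak_val6 W.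
    by case/orP: i0P => /eqP->.
  rewrite wi0 /=; have [Aw|nAw] := boolP (w i0 \in A).
    by apply: (exch_set_btw pyz); rewrite exch_flip_in.
  by rewrite /rho exch_flip_out.
have other i0 : i0 < m.+4.+3 -> ~~ ((i0 == m.+3) || (i0 == m.+4.+2)) ->
    ~~ (z < w i0 < y) /\ rho (w i0) = w i0.
  rewrite negb_or => i0m /andP[i03 i06].
  have wi0 := weak_val_other W i0m i03 i06; rewrite w0 w1 in wi0.
  by split=> //; apply: exch_flip_out; apply: contra wi0 => /(exch_set_btw pyz).
have [iS|iO] := boolP ((i == m.+3) || (i == m.+4.+2));
  have [jS|jO] := boolP ((j == m.+3) || (j == m.+4.+2)).
- have -> : i = j by move: nij; rewrite /swapped; lia.
  by rewrite !ltnn.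
- by have := special i iS; have [+ ->] := other j jm jO; lia.
- by have := special j jS; have [+ ->] := other i im iO; lia.
- by have [_ ->] := other i im iO; have [_ ->] := other j jm jO.
Qed.

Lemma weak_exchange w : weak_instance p w -> w 1 = y ->
  weak_instance (exchange y p) (fun i => rho (w i)).
Proof.
move=> W w1; have := weak_parent W (isT : 0 < m.+4.+2).
rewrite w1 pyz => -[/esym w0]; apply: (weak_flip W w0 w1) => i im.
have [cA|] := boolP ((rho (w i.+1) < z) || (rho (w i.+1) \in A)).
  by rewrite exchange_moved // /rho exch_flipK (weak_parent W).
move=> /[dup] /exchange_kept->; rewrite exch_flip_in negb_or => /andP[cz cA].
rewrite /rho (exch_flip_out cA) (weak_parent W) // exch_flip_out //.
apply: (weak_notin W w1); [lia | | lia].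
(* Position [m.+3] is followed by the minimum of the pattern, a label below [z], whose edge would
   have been moved. *)
apply: contra cz => /eqP i3; rewrite i3 /rho exch_flip_out -?i3 //.
by rewrite -w0 i3; apply: weak_val4 W.
Qed.

Lemma weak_unexchange w : weak_instance (exchange y p) w -> w 1 = y ->
  weak_instance p (fun i => rho (w i)).
Proof.
move=> W w1; have := weak_parent W (isT : 0 < m.+4.+2).
rewrite w1 exchange_parent => -[/esym w0]; apply: (weak_flip W w0 w1) => i im.
have [cA|] := boolP ((w i.+1 < z) || (w i.+1 \in A)).
  have := weak_parent W im; rewrite exchange_moved //.
  by case: (p _) => //= x [<-]; rewrite /rho exch_flipK.
move=> /[dup] cN; rewrite negb_or => /andP[cz cA].
have := weak_parent W im; rewrite exchange_kept // {1}/rho exch_flip_out // => ->.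
rewrite /rho exch_flip_out //; apply/negP => /(exch_set_btw pyz).
rewrite -w0 -w1; apply/negP; apply: (weak_val_other W); [lia | | lia].
by apply: contra cz => /eqP->; rewrite -w0; apply: weak_val4 W.
Qed.
End ExchangeRoot.

(** The flip carries weak instances at [y] before the exchange to those after it and back, and
    preserves the set. Hence a second exchange uses the same flip. *)
Lemma exch_set_exchange p y : exch_set (exchange y p) y = exch_set p y.
Proof.
case pyz: (p y) => [z|]; last by rewrite /exchange pyz.
apply/setP => x; rewrite -[in RHS]exch_flip_in.
apply/exch_setP/exch_setP => -[w [W w1 xw]];
  exists (fun i => exch_flip p y (w i)); rewrite w1 exch_flip_root; split=> //.
- exact: weak_unexchange pyz _ W w1.
- by case: xw => ->; tauto.
- exact: weak_exchange pyz _ W w1.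
- by case: xw => <-; rewrite exch_flipK; tauto.
Qed.

Lemma exchangeK p y : exchange y (exchange y p) = p.
Proof.
case pyz: (p y) => [z|]; last by rewrite /exchange !pyz.
have eA := exch_set_exchange p y.
have eF : exch_flip (exchange y p) y = exch_flip p y by rewrite /exch_flip eA.
have pyz' := exchange_parent pyz; apply/ffunP => c.
have [cA|cA] := boolP ((c < z) || (c \in exch_set p y)); last first.
  by rewrite (exchange_kept pyz') ?eA // (exchange_kept pyz).
rewrite (exchange_moved pyz') ?eA // eF (exchange_moved pyz) ?exch_flipK.
  by case: (p c) => //= u; rewrite exch_flipK.
rewrite exch_flip_in; case/orP: cA => [cz|->]; last by rewrite orbT.
by rewrite exch_flip_out ?cz //; apply/negP => /(exch_set_btw pyz); lia.
Qed.

(** * Instances with different second vertices *)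

Lemma weak_min p w i : weak_instance p w -> 0 < i < m.+4.+3 -> i != m.+4 ->
  w 0 < w i.
Proof.
move=> W im i4; have := weak_val01 W; have := weak_val3 W; have := weak_val6 W.
have := @weak_val_big _ _ W i.
have [->|i1] := eqVneq i 1; first lia.
have [->|i3] := eqVneq i m.+3; first lia.
by have [->|i6] := eqVneq i m.+4.+2; lia.
Qed.

(* Overlapping instances would make a window of the pattern through a swapped
   position order-isomorphic to a prefix; comparing the positions of the minimum,
   or the last two steps, rules this out. *)
Lemma weak_overlap p u w e j :
    weak_instance p u -> weak_instance p w -> u 1 <> w 1 ->
    (e == m.+3) || (e == m.+4.+2) -> 0 < j < m.+4.+3 ->
  u j <> w e.
Proof.
move=> U W uw1 eS jm ujwe.
(* Parents are unique, so the two paths coincide upwards from the common vertex. *)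
have up t : t <= j -> t <= e -> u (j - t) = w (e - t).
  elim: t => [|t IH] tj te; first by rewrite !subn0.
  have := IH (ltnW tj) (ltnW te).
  rewrite -(subnSK tj) -(subnSK te) => ut; apply: Some_inj.
  by rewrite -(weak_parent U) -1?(weak_parent W) ?ut //; lia.
have [ej|je] := leqP e j.
  have [eje|eje] := eqVneq e j.
    have /up : e.-1 <= j by lia.
    by rewrite leq_pred -eje (_ : e - e.-1 = 1); [move/(_ isT) | lia].
  (* Now [w] starts inside [u], and the minimum of [u] sits at a position of [w] with label above
     [w 0]. So [u m.+4 > w 0 = u (j - e) > u 0], against [weak_val4]. *)
  have e3 : e = m.+3 by lia.
  have ui : u (j - e) = w 0 by rewrite up ?subnn.
  have u4 : u m.+4 = w (m.+4 - (j - e)).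
    have := up (j - m.+4); rewrite (_ : j - (j - _) = m.+4); last lia.
    by move=> -> //; [congr w | |]; lia.
  have := weak_val4 U; have : u 0 < u (j - e) by apply: (weak_min U); lia.
  have : w 0 < w (m.+4 - (j - e)) by apply: (weak_min W); lia.
  by rewrite ui u4; lia.
(* Now [u] starts inside [w], at position [e - j]. *)
have wi t : t <= j -> u t = w (e - j + t).
  by move=> tj; rewrite -(subKn tj) up; [congr w | |]; lia.
have u0 := wi 0 isT; rewrite addn0 in u0.
case/orP: eS => /eqP eE.
  (* The labels of [w] at positions 1 to [m.+2] all exceed [w m.+3], so [u] could not rise from its
     start to [u j]. *)
  have : u 0 < u j by apply: (weak_min U); lia.
  rewrite ujwe u0 eE; have := weak_val3 W.
  have [->|ij] := eqVneq (m.+3 - j) 1; first lia.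
  have : w 1 < w (m.+3 - j) by apply: (weak_val_big W); lia.
  lia.
(* Overlaps of two or three vertices fail because [w] ends in a descent while [u] begins with two
   ascents. In longer ones the minimum of [w] sits at position [j - 2 > 0] of [u], so it would
   exceed [u 0 = w (e - j)], itself above [w 0]. *)
have u01 := weak_val01 U.
have w65 : w m.+4.+2 < w m.+4.+1.
  by have := weak_val6 W; have := @weak_val_big _ _ W m.+4.+1; lia.
have [i5|i5] := eqVneq j 1.
  by move: u01; rewrite u0 eE i5 subSS subn0; move: ujwe; rewrite eE i5 => ->; lia.
have [i4|i4] := eqVneq j 2.
  have u12 : u 1 < u 2 by apply: (weak_val_big U); lia.
  move: u12; rewrite wi; last lia.
  by move: ujwe; rewrite eE i4 !subSS subn0 addn1 => ->; lia.
have u4 : u (m.+4 - (e - j)) = w m.+4 by rewrite wi; [congr w|]; lia.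
have : u 0 < u (m.+4 - (e - j)) by apply: (weak_min U); lia.
have : w 0 < w (e - j) by apply: (weak_min W); lia.
by have := weak_val4 W; rewrite u4 u0; lia.
Qed.

Lemma weak_exchange_other p y u : weak_instance p u -> u 1 <> y ->
  weak_instance (exchange y p) u.
Proof.
move=> U uy; case pyz: (p y) => [z|]; last by rewrite /exchange pyz.
have uA j : 0 < j < m.+4.+3 -> u j \notin exch_set p y.
  move=> jm; apply/negP => /exch_setP[w [W w1 uw]]; rewrite -w1 in uy.
  by case: uw; apply: (weak_overlap U W uy); rewrite ?eqxx ?orbT.
split=> [i im|]; last exact: U.2.
have [cA|cA] := boolP ((u i.+1 < z) || (u i.+1 \in exch_set p y)); last first.
  by rewrite (exchange_kept pyz) ?(weak_parent U).
rewrite (exchange_moved pyz) // exch_flip_out ?uA //.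
rewrite (weak_parent U) //= exch_flip_out //.
(* Only [u 0] can lie in the exchange set; but then [u 1 > u 0 > z], and the edge of [u 1] would not
   have been moved. *)
have [i0|i0] := posnP i; last by apply: uA; lia.
move: cA; rewrite (negPf (uA _ _)) // orbF i0.
by apply: contraL => /(exch_set_btw pyz); have := weak_val01 U; lia.
Qed.

(** Vertices no deeper than [y] keep their parents, members of the exchange set hang from [y] along
    exchanged instances, and the rest follow by induction on the old height. *)
Lemma exchange_forest p y : is_forest p -> is_forest (exchange y p).
Proof.
case pyz: (p y) => [z|]; last by rewrite /exchange pyz.
move=> /forest_height[h hp]; apply: rooted_is_forest.
pose rho := exch_flip p y; set q := exchange y p.
have hA x : x \in exch_set p y -> h y < h x.
  have hw w i : weak_instance p w -> 1 < i < m.+4.+3 -> h (w 1) < h (w i).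
    move=> W; elim: i => // i IH im.
    have hi : h (w i) < h (w i.+1) by apply/hp/(weak_parent W); lia.
    have [i1|i1] := eqVneq i 1; first by move: hi; rewrite i1.
    by apply: ltn_trans hi; apply: IH; lia.
  by case/exch_setP=> w [W <- [->|->]]; apply: hw W _; lia.
have rootedS v u : q v = Some u -> rooted q u -> rooted q v.
  exact: HasRootedParent.
have qE v u : v \notin exch_set p y -> p v = Some u ->
    q v = Some u \/ q v = Some (rho u).
  move=> vA vu; have [cA|cA] := boolP ((v < z) || (v \in exch_set p y)).
    by right; rewrite /q (exchange_moved pyz) // exch_flip_out // vu.
  by left; rewrite /q (exchange_kept pyz).
have qN v : v \notin exch_set p y -> p v = None -> rooted q v.
  move=> vA vN; apply: IsRoot.
  have [cA|cA] := boolP ((v < z) || (v \in exch_set p y)).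
    by rewrite /q (exchange_moved pyz) // exch_flip_out // vN.
  by rewrite /q (exchange_kept pyz).
have above v : h v <= h y -> rooted q v.
  have [k] := ubnP (h v); elim: k v => // k IH v hvk hvy.
  have nA x : h x <= h y -> x \notin exch_set p y.
    by move=> hx; apply/negP => /hA; lia.
  case vu: (p v) => [u|]; last by apply: qN; rewrite ?nA.
  have huv := hp _ _ vu; have ru : rooted q u by apply: IH; lia.
  apply: rootedS ru; have [//|->] := qE v u (nA _ hvy) vu.
  by rewrite /rho exch_flip_out // nA //; lia.
have inA x : x \in exch_set p y -> rooted q x.
  rewrite -exch_flip_in => /exch_setP[w [W w1 xw]].
  have rw i : i < m.+4.+2 -> rooted q (rho (w i.+1)).
    elim: i => [|i IH] im; first by rewrite w1 /rho exch_flip_root; apply: above.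
    apply: rootedS (IH _); last lia.
    exact: (weak_parent (weak_exchange pyz W w1)).
  by rewrite -[x](exch_flipK p y); case: xw => ->; apply: rw; lia.
move=> v; have [k] := ubnP (h v); elim: k v => // k IH v hvk.
have [/inA//|vA] := boolP (v \in exch_set p y).
case vu: (p v) => [u|]; last exact: qN.
have huv := hp _ _ vu; have ru : rooted q u by apply: IH; lia.
have [vu'|vu'] := qE v u vA vu; apply: rootedS vu' _ => //.
have [uA|uA] := boolP (u \in exch_set p y); first by apply: inA; rewrite exch_flip_in.
by rewrite /rho exch_flip_out.
Qed.

(** * Equinumerosity of the avoiders, one second vertex at a time *)

Definition critical_order (b : bool) w : bool :=
  if b then w m.+4.+2 < w m.+3 else w m.+3 < w m.+4.+2.

(* Interpolates between the avoiders of the two patterns, at S = set0 and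
   S = setT: S collects the second vertices whose instances of the second
   pattern, rather than the first, are forbidden. *)
Definition mixed_avoiders (S : {set 'I_n}) : {set parent_fun n} :=
  [set p | is_forest p && [forall w : {ffun 'I_m.+4.+3 -> 'I_n},
     weak_instanceb p w ==>
       ~~ critical_order (w (inord 1) \in S) (fun i => w (inord i))]].

Lemma mixed_avoidersP (S : {set 'I_n}) p :
  reflect (is_forest p /\
           forall w, weak_instance p w -> ~~ critical_order (w 1 \in S) w)
          (p \in mixed_avoiders S).
Proof.
rewrite inE; apply: (iffP andP) => -[fp avp]; split=> //.
  move=> w W; have := forallP avp [ffun i : 'I_m.+4.+3 => w i].
  rewrite /critical_order !ffunE !inordK; try lia.
  move=> /implyP-> //; apply/weak_instanceP; apply: eq_weak_instance W => i im.
  by rewrite ffunE inordK.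
by apply/forallP => w; apply/implyP => /weak_instanceP; apply: avp.
Qed.

(** Instances at other second vertices are unaffected. At [y] the flip reverses the critical
    comparison, and toggling [y] reverses which one is forbidden. *)
Lemma exchange_mixed_avoiders (S S' : {set 'I_n}) y p :
    (forall x, (x \in S') = (x \in S) (+) (x == y)) ->
  p \in mixed_avoiders S -> exchange y p \in mixed_avoiders S'.
Proof.
move=> SS' /mixed_avoidersP[fp avp]; apply/mixed_avoidersP.
split=> [|w W]; first exact: exchange_forest.
have [w1|/eqP w1] := eqVneq (w 1) y; last first.
  have := weak_exchange_other W w1; rewrite exchangeK => /avp.
  by rewrite SS' (negPf (introN eqP w1)) addbF.
have [z pyz] : exists z, p y = Some z.
  case pyz: (p y) => [z|]; first by exists z.
  have := weak_parent W (isT : 0 < m.+4.+2).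
  by rewrite w1 /exchange pyz pyz.
have /avp := weak_unexchange pyz W w1.
have wA i : (i == m.+3) || (i == m.+4.+2) -> w i \in exch_set p y.
  move=> iS; rewrite -exch_set_exchange; apply/exch_setP.
  by exists w; split=> //; case/orP: iS => /eqP->; tauto.
rewrite w1 exch_flip_root SS' eqxx addbT /critical_order.
by rewrite !exch_flip_ltn ?wA ?eqxx ?orbT //; case: ifP.
Qed.

(** Toggling one vertex is symmetric and the exchange is injective, which gives both inequalities;
    [S] is emptied one vertex at a time. *)
Lemma card_mixed_avoiders S : #|mixed_avoiders S| = #|mixed_avoiders set0|.
Proof.
have le (S1 S2 : {set 'I_n}) y : (forall x, (x \in S2) = (x \in S1) (+) (x == y)) ->
    #|mixed_avoiders S1| <= #|mixed_avoiders S2|.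
  move=> S12; rewrite -(card_imset _ (can_inj (@exchangeK^~ y))).
  apply: subset_leq_card; apply/subsetP => _ /imsetP[p pS ->].
  exact: exchange_mixed_avoiders pS.
have [k] := ubnP #|S|; elim: k S => // k IH S Sk.
have [->//|[y Sy]] := set_0Vmem S.
rewrite -(IH (S :\ y)); last by move: Sk; rewrite (cardsD1 y S) Sy; lia.
apply/eqP; rewrite eqn_leq; apply/andP; split; apply: (le _ _ y) => x;
  by rewrite !inE; case: eqVneq => [->|]; rewrite ?Sy ?addbF.
Qed.

(** A weak instance leaves open only the comparison of the swapped positions; [critical_order]
    supplies it, for the first pattern if [b] is false and for the second if it is true. *)
Lemma avoiders_mixed (b : bool) (sg : 'S_m.+4.+3) :
    (forall i j, i < m.+4.+3 -> j < m.+4.+3 -> ~~ swapped i j ->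
       (sg (inord i) < sg (inord j)) = (s i < s j)) ->
    (sg (inord m.+3) < sg (inord m.+4.+2)) = ~~ b ->
  avoiders n sg = mixed_avoiders (if b then setT else set0).
Proof.
move=> sgE sgP; have sgK : (sg (inord m.+4.+2) < sg (inord m.+3)) = b.
  have ne : sg (inord m.+4.+2) != sg (inord m.+3) :> nat.
    apply/eqP => /val_inj/perm_inj/(congr1 val); rewrite /= !inordK; lia.
  by move: sgP ne; case: b; lia.
have inb x : (x \in (if b then setT else set0 : {set 'I_n})) = b.
  by case: b {sgP sgK}; rewrite inE.
apply/setP => p; rewrite [LHS]inE; apply/andP/mixed_avoidersP.
  case=> fp avp; split=> // w W; apply: contra avp; rewrite inb => co.
  apply/existsP; exists [ffun i : 'I_m.+4.+3 => w i].
  apply/forallP => i; apply/forallP => j; rewrite !ffunE; apply/andP; split.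
    apply/implyP => /eqP ij; rewrite ij (weak_parent W) //.
    by have := ltn_ord j; rewrite -[nat_of_ord j]/(val j) ij.
  have [sij|nij] := boolP (swapped i j); last first.
    by rewrite (weak_lt W) // -sgE // !inord_val.
  move: co sgP sgK; rewrite /critical_order.
  have -> : sg i = sg (inord i) by rewrite inord_val.
  have -> : sg j = sg (inord j) by rewrite inord_val.
  case/orP: sij => /andP[/eqP-> /eqP->]; by case: b {inb}; lia.
case=> fp avp; split=> //; apply/negP => /existsP[w /forallP wP].
have wP' i j : i < m.+4.+3 -> j < m.+4.+3 ->
    ((j == i.+1) ==> (p (w (inord j)) == Some (w (inord i)))) /\
    (w (inord i) < w (inord j)) = (sg (inord i) < sg (inord j)).
  move=> im jm; have /forallP/(_ (inord j))/andP[+ /eqP] := wP (inord i).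
  by rewrite /= !inordK.
have W : weak_instance p (fun i => w (inord i)).
  split=> [i im|i j im jm nij]; last by rewrite (wP' i j im jm).2 sgE.
  by have [] := wP' i i.+1 (ltnW im) im; rewrite eqxx => /eqP.
have := avp _ W; rewrite inb /critical_order !(wP' _ _ _ _).2; try lia.
by rewrite sgP sgK; case: (b).
Qed.
End Exchange.

(** * Counting permutations with prescribed values *)

Lemma exists_perm_map (T : finType) (xs ys : seq T) :
  uniq xs -> uniq ys -> size xs = size ys -> exists g : {perm T}, map g xs = ys.
Proof.
elim: xs ys => [|x xs IH] [|y ys] //=; first by exists 1%g.
move=> /andP[xxs uxs] /andP[yys uys] [/(IH _ uxs uys)[g gxs]].
exists (g * tperm (g x) y)%g; rewrite permM tpermL -[in RHS]gxs; congr (_ :: _).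
apply/eq_in_map => x' x'xs; rewrite permM tpermD //.
  by apply: contraNneq xxs => /perm_inj->.
by apply: contraNneq yys => ->; rewrite -gxs map_f.
Qed.

(** One solution [g0], preceded by any permutation fixing [xs] pointwise, is again a solution. *)
Lemma card_perm_map_ge (T : finType) (xs ys : seq T) :
    uniq xs -> uniq ys -> size xs = size ys ->
  ((#|T| - size xs)`! <= #|[set g : {perm T} | map g xs == ys]|)%N.
Proof.
move=> uxs uys /(exists_perm_map uxs uys)[g0 g0xs].
have <- : #|[set x | x \notin xs]| = (#|T| - size xs)%N.
  by rewrite cardsE -(card_uniqP uxs) -(cardC (mem xs)) addKn.
rewrite -card_perm -(card_imset (perm_on _) (mulIg g0)).
apply: subset_leq_card; apply/subsetP => _ /imsetP[h hP ->].
rewrite inE -g0xs; apply/eqP/eq_in_map => x xxs; rewrite permM.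
by rewrite (out_perm hP) // inE xxs.
Qed.

(** * The family of patterns and their partners *)

Section PatternFamily.
Local Open Scope nat_scope.
Context (m : nat).

(* The patterns 2 5 rho 3 1 x 4 in one-line notation. *)
Definition family_positions : seq 'I_m.+4.+3 :=
  [:: inord 0; inord 1; inord m.+3; inord m.+4; inord m.+4.+2].
Definition family_values : seq 'I_m.+4.+3 :=
  [:: inord 1; inord 4; inord 2; inord 0; inord 3].
Definition family : {set 'S_m.+4.+3} :=
  [set pi : 'S_m.+4.+3 | [seq pi i | i <- family_positions] == family_values].

Lemma card_family : m.+2`! <= #|family|.
Proof.
have unq (xs : seq nat) : all (gtn m.+4.+3) xs -> uniq xs ->
    uniq (map inord xs : seq 'I_m.+4.+3).
  move=> /allP xsm; rewrite map_inj_in_uniq // => i j /xsm im /xsm jm.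
  by move=> /(congr1 val); rewrite /= !inordK.
have upos : uniq family_positions.
  by apply: (unq [:: 0; 1; m.+3; m.+4; m.+4.+2]); rewrite /= ?inE; lia.
have uval : uniq family_values by apply: (unq [:: 1; 4; 2; 0; 3]).
have := card_perm_map_ge upos uval erefl.
by rewrite card_ord /= !subSS subn0.
Qed.

Context (pi : 'S_m.+4.+3).
Hypothesis pi_family : pi \in family.
Let s i : nat := pi (inord i).

(** Products apply the left factor first, so two values are exchanged, namely 3 and 4 in one-line
    notation. *)
Definition swap23 : 'S_m.+4.+3 := (pi * tperm (inord 2) (inord 3))%g.

Lemma family_spec : [/\ s 0 = 1, s 1 = 4, s m.+3 = 2, s m.+4 = 0 & s m.+4.+2 = 3].
Proof.
move: pi_family; rewrite inE => /eqP[e0 e1 e3 e4 e6].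
by rewrite /s e0 e1 e3 e4 e6 !inordK; try lia.
Qed.

Lemma family_inj i j : i < m.+4.+3 -> j < m.+4.+3 -> s i = s j -> i = j.
Proof.
by move=> im jm /val_inj/perm_inj/(congr1 val); rewrite /= !inordK.
Qed.

Lemma family_big i : 1 < i < m.+4.+2 -> i != m.+3 -> i != m.+4 -> 4 < s i.
Proof.
move=> im i3 i4; have [s0 s1 s3 s4 s6] := family_spec.
have ne j : j < m.+4.+3 -> i != j -> s i != s j.
  by move=> jm; apply: contraNneq => /family_inj->; lia.
have := ne 0; have := ne 1; have := ne m.+3; have := ne m.+4; have := ne m.+4.+2.
by rewrite s0 s1 s3 s4 s6; lia.
Qed.

Lemma swap23E i :
  swap23 (inord i) = (if s i == 2 then 3 else if s i == 3 then 2 else s i) :> nat.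
Proof.
rewrite /swap23 permM /s; case: tpermP => [->|->|n2 n3].
- by rewrite !inordK //; lia.
- by rewrite !inordK //; lia.
by case: eqP => [e|_]; [case: n2 | case: eqP => // e; case: n3];
  apply: val_inj; rewrite /= inordK.
Qed.

Lemma family_wilf : cforest_wilf_equiv pi swap23.
Proof.
move=> n; have [s0 s1 s3 s4 s6] := family_spec.
rewrite (@avoiders_mixed m s s0 s1 s3 s4 s6 n false) => [|//|]; last by rewrite -!/(s _) s3 s6.
rewrite (@avoiders_mixed m s s0 s1 s3 s4 s6 n true) => [|i j im jm nij|]; last 2 first.
(* Exchanging the adjacent values 2 and 3 alters only their mutual comparison, which [nij]
   excludes. *)
- have i3 : s i = 2 -> i = m.+3 by rewrite -s3; apply: family_inj => //; lia.
  have i6 : s i = 3 -> i = m.+4.+2 by rewrite -s6; apply: family_inj => //; lia.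
  have j3 : s j = 2 -> j = m.+3 by rewrite -s3; apply: family_inj => //; lia.
  have j6 : s j = 3 -> j = m.+4.+2 by rewrite -s6; apply: family_inj => //; lia.
  rewrite /swapped in nij; rewrite !swap23E.
  move: (s i) (s j) i3 i6 j3 j6 => a b i3 i6 j3 j6.
  by case: (eqVneq a 2); case: (eqVneq a 3); case: (eqVneq b 2);
    case: (eqVneq b 3); lia.
- by rewrite !swap23E s3 s6.
by apply/esym; apply: card_mixed_avoiders => //; apply: family_big.
Qed.

Lemma swap23_neq : swap23 != pi.
Proof.
have [_ _ s3 _ _] := family_spec.
apply/eqP => /(congr1 (fun g : 'S__ => val (g (inord m.+3)))) /=.
by rewrite swap23E -/(s _) s3.
Qed.

Lemma swap23_neq_compl : swap23 != compl pi.
Proof.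
have [s0 _ _ _ _] := family_spec.
(* At position 0 the partner has value 1 and the complement [m + 5]. *)
apply/eqP => /(congr1 (fun g : 'S__ => val (g (inord 0)))) /=.
by rewrite swap23E permE /= -!/(s _) s0 subSS subn1.
Qed.
End PatternFamily.

(** * Exponential decay against polynomial growth *)

Lemma bernoulli_le (R : realFieldType) (x : R) n : -1 <= x -> 1 + n%:R * x <= (1 + x) ^+ n.
Proof.
move=> x1; elim: n => [|n IH]; first by rewrite mul0r addr0 expr0.
have x0 : 0 <= 1 + x by lra.
rewrite exprS -natr1; apply: le_trans (ler_wpM2l x0 IH).
have : 0 <= n%:R * x ^+ 2 by rewrite mulr_ge0 ?sqr_ge0.
rewrite expr2; nra.
Qed.

(** Bernoulli gives [c <= (1 - e) ^+ k.+1], and [n (1 - e)^n] is bounded by [1/e]. So [n^(k+1) c^n]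
    is bounded, and the spare factor [n] absorbs the bound. *)
Lemma exp_poly_le1 (R : realType) (c : R) k : 0 < c -> c < 1 ->
  exists n0 : nat, forall n, (n0 < n)%N -> n%:R ^+ k * c ^+ n <= 1.
Proof.
move=> c0 c1; pose e := (1 - c) / k.+1%:R.
have k0 : 0 < k.+1%:R :> R by rewrite ltr0n.
have e0 : 0 < e by rewrite divr_gt0 // subr_gt0.
have ke : k.+1%:R * e = 1 - c by rewrite mulrC divfK // gt_eqF.
have e1 : e < 1.
  by rewrite ltr_pdivrMr // mul1r; apply: (@lt_le_trans _ _ 1); [lra | rewrite ler1n].
have ce : c <= (1 - e) ^+ k.+1.
  by apply: le_trans (bernoulli_le k.+1 _); [rewrite mulrN ke|]; lra.
have ne n : n%:R * (1 - e) ^+ n <= e^-1.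
  have p0 : 0 <= (1 - e) ^+ n by rewrite exprn_ge0 //; lra.
  have h1 : (1 - e) ^+ n * (1 + e) ^+ n <= 1.
    by rewrite -exprMn exprn_ile1 //; nra.
  have h2 : n%:R * e <= (1 + e) ^+ n.
    by apply: le_trans (bernoulli_le n _); lra.
  rewrite -[e^-1]mul1r ler_pdivlMr //; apply: le_trans h1.
  by rewrite mulrAC mulrC; apply: ler_wpM2l.
exists (Num.bound (e^-1 ^+ k.+1)) => n nb.
have n0 : 0 < n%:R :> R by rewrite ltr0n (leq_ltn_trans _ nb).
rewrite -(ler_pM2l n0) mulr1 mulrA -exprS.
have le1 : c ^+ n <= ((1 - e) ^+ n) ^+ k.+1.
  by rewrite exprAC; apply: lerXn2r; rewrite ?nnegrE ?(ltW c0) ?exprn_ge0 //; lra.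
apply: le_trans (ler_wpM2l _ le1) _; first by rewrite exprn_ge0 // ltW.
rewrite -exprMn; apply: (@le_trans _ _ (e^-1 ^+ k.+1)).
  apply: lerXn2r (ne n); rewrite nnegrE ?invr_ge0 ?(ltW e0) //.
  by rewrite mulr_ge0 ?exprn_ge0 ?ltW //; lra.
apply/ltW; apply: lt_trans (_ : (Num.bound (e^-1 ^+ k.+1))%:R < _); last by rewrite ltr_nat.
by apply: archi_boundP; rewrite exprn_ge0 // invr_ge0 ltW.
Qed.

Theorem theorem1p6 (R : realType) (c : R) :
  0 < c -> c < 1 ->
  exists nc : nat, forall n : nat, (nc < n)%N ->
    exists S : {set 'S_n},
      c ^+ n * (n`!)%:R <= (#|S|)%:R /\
      (forall pi : 'S_n, pi \in S ->
         exists pi' : 'S_n, pi' != pi /\ pi' != compl pi /\ cforest_wilf_equiv pi pi').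
Proof.
move=> c0 c1; have [n0 nP] := exp_poly_le1 5 c0 c1.
(* Adding 6 forces length at least 7, the shortest in the family. *)
exists (n0 + 6)%N => n; case: n => [|[|[|[|[|[|[|m]]]]]]]; try lia.
move=> nm; exists (family m); split; last first.
  move=> pi piF; exists (swap23 pi).
  by rewrite swap23_neq // swap23_neq_compl //; split=> //; split=> //; apply: family_wilf.
apply: le_trans (_ : (m.+2)`!%:R <= _); last by rewrite ler_nat card_family.
(* The five prescribed values cost a factor of at most [n^5], which [c^n] absorbs by the choice of
   [n0]. *)
have fact5 : (m.+4.+3`! <= m.+4.+3 ^ 5 * m.+2`!)%N.
  rewrite !factS !mulnA leq_mul2r; apply/orP; right.
  by rewrite !expnS expn0 muln1 !mulnA !leq_mul //; lia.
apply: le_trans (_ : c ^+ m.+4.+3 * (m.+4.+3 ^ 5 * m.+2`!)%:R <= _).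
  by rewrite ler_wpM2l ?ler_nat // exprn_ge0 // ltW.
rewrite natrM natrX mulrA mulrC -[leRHS]mulr1 ler_wpM2l //.
by rewrite mulrC; apply: nP; lia.
Qed.
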